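(* Let $G$ be an infinite connected graph with maximum degree $\Delta$, where $3 \leq \Delta < \infty$. Then $D(G) \leq \Delta - 1$.
   Context: A distinguishing $k$-colouring of a graph $G=(V,E)$ is a map $c\colon V\to\{0,\dots,k-1\}$ such that the identity is the only automorphism $\gamma$ of $G$ with $c\circ\gamma=c$. The distinguishing number $D(G)$ is the least $k$ such that $G$ admits a distinguishing $k$-colouring. *)

(* Defs.v *)
From Stdlib Require Import List Relations.
Import ListNotations.

Definition simple_graph {V : Type} (adj : V -> V -> Prop) : Prop :=
  (forall x y, adj x y -> adj y x) /\ (forall x, ~ adj x x).

Definition infinite_type (V : Type) : Prop :=
  ~ exists l : list V, forall v, In v l.

Definition connected {V : Type} (adj : V -> V -> Prop) : Prop :=
  forall x y, clos_refl_trans V adj x y.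

Definition has_degree {V : Type} (adj : V -> V -> Prop) (v : V) (d : nat) : Prop :=
  exists l : list V, NoDup l /\ (forall w, adj v w <-> In w l) /\ length l = d.

Definition max_degree {V : Type} (adj : V -> V -> Prop) (Delta : nat) : Prop :=
  (forall v, exists d, has_degree adj v d /\ d <= Delta) /\
  (exists v, has_degree adj v Delta).

Definition automorphism {V : Type} (adj : V -> V -> Prop) (g : V -> V) : Prop :=
  (exists h : V -> V, (forall x, h (g x) = x) /\ (forall x, g (h x) = x)) /\
  (forall x y, adj x y <-> adj (g x) (g y)).

Definition distinguishing_colouring {V : Type} (adj : V -> V -> Prop)
    (k : nat) (c : V -> nat) : Prop :=
  (forall v, c v < k) /\
  (forall g, automorphism adj g -> (forall v, c (g v) = c v) -> forall v, g v = v).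

Definition distinguishing_number_le {V : Type} (adj : V -> V -> Prop) (k : nat) : Prop :=
  exists c : V -> nat, distinguishing_colouring adj k c.

(* Main.v *)
Require Import Defs.
From Stdlib Require Import List Relations.
From Stdlib Require Import Lia Arith Classical ClassicalEpsilon.
From Stdlib Require Import FunctionalExtensionality PropExtensionality.
Import ListNotations.

(** Put [k = Delta - 1] and measure levels from a root [r]. A set [D] containing [r], the spine,
    gets colour 0. Two vertices off [D] are twins if they are on the same level and have the same
    neighbours among the lower levels and [D]; if twins always get different colours, an
    automorphism preserving the colours and fixing [D] pointwise is trivial, by induction on
    levels. A class of twins has at most [k] members, and fewer than [k] if it is adjacent to an
    inner vertex of the spine, so colour 0 can be reserved, off [D], for classes with exactly [k]
    members. Hence an upward walk through colour 0 that avoids [D] ends up in a part where [G]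
    branches like the [Delta]-regular tree; call geodesic rays that do so tree-like.

    If some geodesic ray [R] is tail-equal to every tree-like ray, take [D = R]. The image of [R]
    under a colour-preserving automorphism is a walk through colour 0, so it has a common tail
    with [R]; a proper shift is impossible (pull the tail back along it), and then [R] is fixed
    vertex by vertex from its tail down to [r].

    Otherwise there are two tree-like rays with disjoint tails. Take [D] to be one of them and a
    tail of the other. At the levels of a sparse sequence, used alternately for the two rays, the
    neighbours of the ray off [D] avoid the colour [k - 1] (and may use colour 0); off [D] every
    vertex with an off-[D] child outside these deviating neighbourhoods sees colour [k - 1]. This
    identifies both tails. A colour-preserving automorphism that fixes both tails but not all of
    [D] must first move something next to a deviating vertex on each ray; for a given position on
    one ray, only finitely many positions on the other are possible, for any automorphism of
    [G], so a sufficiently sparse sequence excludes this. *)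

(** * Graph notions, sequences and automorphisms *)

Definition degree_le {V : Type} (adj : V -> V -> Prop) (d : nat) (v : V) : Prop :=
  exists l : list V, NoDup l /\ (forall w, adj v w <-> In w l) /\ length l <= d.

(** These properties characterise the distance from [r] in a connected graph. *)
Definition rooted_levels {V : Type} (adj : V -> V -> Prop) (level : V -> nat) (r : V) : Prop :=
  level r = 0 /\
  (forall x, level x = 0 -> x = r) /\
  (forall x y, adj x y -> level y <= S (level x)) /\
  (forall y n, level y = S n -> exists x, adj x y /\ level x = n).

Definition fixes_from {V : Type} (f : V -> V) (R : nat -> V) (n : nat) : Prop :=
  forall i, n <= i -> f (R i) = R i.

Definition eventually_equal {V : Type} (R T : nat -> V) : Prop :=
  exists N, forall n, N <= n -> R n = T n.

Lemma least_nat (P : nat -> Prop) :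
  (exists n, P n) -> exists n, P n /\ forall m, P m -> n <= m.
Proof.
  intros [n Hn]. revert Hn. pattern n. apply (well_founded_induction lt_wf).
  clear n. intros n IH Hn.
  destruct (classic (exists m, P m /\ m < n)) as [[m [Hm Hlt]]|Hno].
  - exact (IH m Hlt Hm).
  - exists n. split; [exact Hn|]. intros m Hm.
    destruct (le_lt_dec n m); [assumption|]. exfalso. apply Hno. eauto.
Qed.

Lemma uniform_bound {A : Type} (P : A -> nat -> Prop) (l : list A) :
  (forall x, In x l -> exists b, forall m, b <= m -> P x m) ->
  exists b, forall x m, In x l -> b <= m -> P x m.
Proof.
  induction l as [|a l IH]; intros H.
  - exists 0. intros x m [].
  - destruct IH as [b1 H1]. { intros x Hx. apply H. now right. }
    destruct (H a) as [b2 H2]. { now left. }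
    exists (b1 + b2). intros x m [->|Hx] Hm; [apply H2|apply H1]; auto; lia.
Qed.

(** The quantity [f n + C - n] never increases, so it is constant from the point where it attains
    its minimum. The lower bound on [f] keeps the truncated subtraction exact. *)
Lemma slope_one_eventually (f : nat -> nat) (C : nat) :
  (forall n, f (S n) <= S (f n)) -> (forall n, n <= f n + C) ->
  exists N, forall n, N <= n -> f (S n) = S (f n).
Proof.
  intros Hstep Hlow.
  destruct (least_nat (fun d => exists n, f n + C - n = d)) as [d [[N HN] Hmin]].
  { now exists (f 0 + C - 0), 0. }
  exists N.
  assert (Hconst : forall n, N <= n -> f n + C - n = d).
  { intros n Hn. assert (Hle : f n + C - n <= d).
    { induction Hn as [|n Hn IH]; [lia|]. specialize (Hstep n). specialize (Hlow n). lia. }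
    assert (d <= f n + C - n) by (apply Hmin; now exists n). lia. }
  intros n Hn. pose proof (Hconst n Hn). pose proof (Hconst (S n) ltac:(lia)).
  pose proof (Hlow n). pose proof (Hlow (S n)). lia.
Qed.

Lemma slope_one_run (f : nat -> nat) N :
  (forall n, N <= n -> f (S n) = S (f n)) -> forall j, f (N + j) = f N + j.
Proof.
  intros H j. induction j as [|j IH]; [now rewrite !Nat.add_0_r|].
  rewrite Nat.add_succ_r, H by lia. lia.
Qed.

Lemma dependent_choice {A : Type} (P : A -> Prop) (E : A -> A -> Prop) (a : A) :
  P a -> (forall x, P x -> exists y, P y /\ E x y) ->
  exists f : nat -> A, f 0 = a /\ forall n, P (f n) /\ E (f n) (f (S n)).
Proof.
  intros Ha Hstep.
  assert (Hch : exists g : A -> A, forall x, P x -> P (g x) /\ E x (g x)).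
  { exists (fun x => epsilon (inhabits a) (fun y => P y /\ E x y)).
    intros x Hx. apply epsilon_spec. now apply Hstep. }
  destruct Hch as [g Hg].
  exists (fun n => Nat.iter n g a). split; [reflexivity|].
  assert (HP : forall n, P (Nat.iter n g a)).
  { induction n; [exact Ha|]. simpl. now apply Hg. }
  intros n. split; [apply HP|]. simpl. apply Hg, HP.
Qed.

Lemma automorphism_inverse {V : Type} (adj : V -> V -> Prop) (g : V -> V) :
  automorphism adj g ->
  exists h, automorphism adj h /\ (forall x, h (g x) = x) /\ (forall x, g (h x) = x).
Proof.
  intros [[h [H1 H2]] Ha]. exists h. split; [|now split].
  split. { exists g. now split. }
  intros x y. rewrite (Ha (h x) (h y)), !H2. tauto.
Qed.

Lemma automorphism_compose {V : Type} (adj : V -> V -> Prop) (f g : V -> V) :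
  automorphism adj f -> automorphism adj g -> automorphism adj (fun x => f (g x)).
Proof.
  intros [[f' [F1 F2]] Hf] [[g' [G1 G2]] Hg]. split.
  - exists (fun x => g' (f' x)). split; intros x; [now rewrite F1, G1|now rewrite G2, F2].
  - intros x y. now rewrite Hg, Hf.
Qed.

Lemma automorphism_injective {V : Type} (adj : V -> V -> Prop) (g : V -> V) (x y : V) :
  automorphism adj g -> g x = g y -> x = y.
Proof. intros [[h [H _]] _] E. rewrite <- (H x), <- (H y). now rewrite E. Qed.

Lemma automorphism_iter {V : Type} (adj : V -> V -> Prop) (g : V -> V) (n : nat) :
  automorphism adj g -> automorphism adj (Nat.iter n g).
Proof.
  intros Hg. induction n as [|n IH].
  - split; [|simpl; tauto]. exists (fun x => x). now split.
  - exact (automorphism_compose adj g (Nat.iter n g) Hg IH).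
Qed.

Lemma exists_levels {V : Type} (adj : V -> V -> Prop) (r : V) :
  connected adj -> exists level, rooted_levels adj level r.
Proof.
  intros Hc.
  set (ball := fix ball n x := match n with
     | 0 => x = r | S m => ball m x \/ exists y, ball m y /\ adj y x end).
  assert (Hex : forall x, exists n, ball n x).
  { intros x. pose proof (Hc r x) as H. apply clos_rt_rtn1 in H.
    induction H as [|y z Hyz _ [n Hn]].
    - now exists 0.
    - exists (S n). right. eauto. }
  assert (Hl : forall x, exists n, ball n x /\ forall m, ball m x -> n <= m).
  { intros x. now apply least_nat. }
  set (level := fun x => proj1_sig (constructive_indefinite_description _ (Hl x))).
  assert (Hb : forall x, ball (level x) x).
  { intros x. unfold level. apply (proj2_sig (constructive_indefinite_description _ (Hl x))). }
  assert (Hm : forall x m, ball m x -> level x <= m).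
  { intros x. unfold level. apply (proj2_sig (constructive_indefinite_description _ (Hl x))). }
  exists level. repeat split.
  - specialize (Hm r 0 eq_refl). lia.
  - intros x Hx. specialize (Hb x). rewrite Hx in Hb. exact Hb.
  - intros x y Hxy. apply Hm. right. exists x. split; [apply Hb|exact Hxy].
  - intros y n Hy. specialize (Hb y) as Hby. rewrite Hy in Hby.
    destruct Hby as [Hby|[x [Hx Hxy]]].
    + apply Hm in Hby. lia.
    + exists x. split; [exact Hxy|]. apply Hm in Hx as Hx'.
      assert (level y <= S (level x)).
      { apply Hm. right. exists x. split; [apply Hb|exact Hxy]. }
      lia.
Qed.

(** * Levels and geodesic rays *)

Section Levels.
Context {V : Type} (adj : V -> V -> Prop) (level : V -> nat) (r : V) (d : nat).
Context (adj_sym : forall x y, adj x y -> adj y x).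
Context (levels : rooted_levels adj level r).
Context (deg : forall v, degree_le adj d v).

Lemma level_root : level r = 0.
Proof. apply levels. Qed.

Lemma level_zero x : level x = 0 -> x = r.
Proof. apply levels. Qed.

Lemma level_step x y : adj x y -> level y <= S (level x).
Proof. apply levels. Qed.

Lemma level_parent y n : level y = S n -> exists x, adj x y /\ level x = n.
Proof. apply levels. Qed.

Lemma neighbours_bound v l :
  NoDup l -> (forall w, In w l -> adj v w) -> length l <= d.
Proof.
  intros Hl Hadj. destruct (deg v) as [n [_ [Hn Hlen]]].
  enough (length l <= length n) by lia.
  apply NoDup_incl_length; [exact Hl|]. intros w Hw. now apply Hn, Hadj.
Qed.

Lemma neighbours_exhausted v l w :
  NoDup l -> (forall x, In x l -> adj v x) -> length l = d -> adj v w -> In w l.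
Proof.
  intros Hl Hadj Hlen Hw. apply NNPP. intros Hn.
  assert (length (w :: l) <= d).
  { apply (neighbours_bound v); [now constructor|]. intros x [<-|Hx]; [exact Hw|exact (Hadj x Hx)]. }
  simpl in *. lia.
Qed.

(** Triangle inequality through [g r], with levels read as distances from [r]. *)
Lemma automorphism_level_le g x :
  automorphism adj g -> level (g x) <= level x + level (g r).
Proof.
  intros [_ Hg]. remember (level x) as n eqn:Hn. symmetry in Hn. revert x Hn.
  induction n as [|n IH]; intros x Hx.
  - rewrite (level_zero x Hx). lia.
  - destruct (level_parent x n Hx) as [y [Hy Hyn]]. specialize (IH y Hyn).
    apply Hg, level_step in Hy. lia.
Qed.

Lemma automorphism_level_ge g x :
  automorphism adj g -> level (g r) <= level (g x) + level x.
Proof.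
  intros [_ Hg]. remember (level x) as n eqn:Hn. symmetry in Hn. revert x Hn.
  induction n as [|n IH]; intros x Hx.
  - rewrite (level_zero x Hx). lia.
  - destruct (level_parent x n Hx) as [y [Hy Hyn]]. specialize (IH y Hyn).
    apply adj_sym, Hg, level_step in Hy. lia.
Qed.

Lemma automorphism_level_fixed g x :
  automorphism adj g -> g r = r -> level (g x) = level x.
Proof.
  intros Hg Hr. destruct (automorphism_inverse adj g Hg) as [h [Hh [Hhg Hgh]]].
  pose proof (automorphism_level_le g x Hg) as H1. rewrite Hr, level_root in H1.
  pose proof (automorphism_level_le h (g x) Hh) as H2.
  assert (Hhr : h r = r) by (rewrite <- Hr at 1; apply Hhg).
  rewrite Hhg, Hhr, level_root in H2. lia.
Qed.

(** Level [n] at index [n] makes the sequence start at the root and be geodesic. *)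
Definition ray (R : nat -> V) : Prop :=
  forall n, level (R n) = n /\ adj (R n) (R (S n)).

Lemma ray_level R n : ray R -> level (R n) = n.
Proof. intros H. apply H. Qed.

Lemma ray_adj R n : ray R -> adj (R n) (R (S n)).
Proof. intros H. apply H. Qed.

Lemma ray_root R : ray R -> R 0 = r.
Proof. intros H. now apply level_zero, H. Qed.

(** The inverse of [g] bounds how far the level can lag behind the index along the image, and each
    step raises the level by at most one. *)
Lemma automorphism_ray_level g R :
  automorphism adj g -> ray R ->
  exists N, forall n, N <= n -> level (g (R (S n))) = S (level (g (R n))).
Proof.
  intros Hg HR. destruct (automorphism_inverse adj g Hg) as [h [Hh [Hhg _]]].
  apply (slope_one_eventually (fun n => level (g (R n))) (level (h r))).
  - intros n. apply level_step. apply (proj1 (proj2 Hg _ _)), HR.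
  - intros n. pose proof (automorphism_level_le h (g (R n)) Hh) as H.
    rewrite Hhg in H. rewrite (ray_level R n HR) in H. lia.
Qed.

Lemma path_from_root x :
  exists p : nat -> V, p (level x) = x /\ (forall i, i <= level x -> level (p i) = i) /\
    (forall i, i < level x -> adj (p i) (p (S i))).
Proof.
  remember (level x) as n eqn:Hn. symmetry in Hn. revert x Hn.
  induction n as [|n IH]; intros x Hx.
  - exists (fun _ => x). repeat split; intros; lia.
  - destruct (level_parent x n Hx) as [y [Hy Hyn]].
    destruct (IH y Hyn) as [p [Hp1 [Hp2 Hp3]]].
    exists (fun i => if le_lt_dec i n then p i else x). repeat split.
    + destruct (le_lt_dec (S n) n); [lia|reflexivity].
    + intros i Hi. destruct (le_lt_dec i n); [now apply Hp2|]. lia.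
    + intros i Hi. destruct (le_lt_dec i n); [|lia].
      destruct (le_lt_dec (S i) n); [apply Hp3; lia|].
      replace i with n by lia. now rewrite Hp1.
Qed.

(** A shortest path from the root to [Q 0] supplies the first [M] vertices. *)
Lemma ray_through (Q : nat -> V) M :
  (forall j, level (Q j) = M + j /\ adj (Q j) (Q (S j))) ->
  exists R, ray R /\ forall j, R (M + j) = Q j.
Proof.
  intros HQ. destruct (path_from_root (Q 0)) as [p [Hp1 [Hp2 Hp3]]].
  assert (H0 : level (Q 0) = M) by (destruct (HQ 0); lia). rewrite H0 in *.
  exists (fun n => if le_lt_dec M n then Q (n - M) else p n). split.
  - intros n. destruct (le_lt_dec M n).
    + destruct (le_lt_dec M (S n)); [|lia].
      replace (S n - M) with (S (n - M)) by lia. destruct (HQ (n - M)). split; [lia|assumption].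
    + split; [apply Hp2; lia|]. destruct (le_lt_dec M (S n)).
      * replace (S n - M) with 0 by lia. rewrite <- Hp1. replace M with (S n) by lia.
        apply Hp3. lia.
      * now apply Hp3.
  - intros j. destruct (le_lt_dec M (M + j)); [|lia]. f_equal. lia.
Qed.

Lemma finite_levels n : exists l : list V, forall x, level x <= n -> In x l.
Proof.
  induction n as [|n [l Hl]].
  - exists [r]. intros x Hx. left. symmetry. apply level_zero. lia.
  - assert (Hnb : forall y, exists s, forall w, adj y w -> In w s).
    { intros y. destruct (deg y) as [s [_ [Hs _]]]. exists s. intros w. apply Hs. }
    assert (Hall : exists s, forall y w, In y l -> adj y w -> In w s).
    { clear Hl. induction l as [|a l [s Hs]].
      - exists []. intros y w [].
      - destruct (Hnb a) as [s' Hs']. exists (s' ++ s). intros y w [->|Hy] Hw;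
        apply in_or_app; eauto. }
    destruct Hall as [s Hs]. exists (l ++ s). intros x Hx. apply in_or_app.
    destruct (le_lt_dec (level x) n) as [H|H]; [left; auto|right].
    destruct (level_parent x n) as [y [Hy Hyn]]; [lia|].
    apply (Hs y x); [apply Hl; lia|exact Hy].
Qed.

Lemma level_inhabited n : infinite_type V -> exists x, level x = n.
Proof.
  intros Hinf. destruct (finite_levels n) as [l Hl].
  apply NNPP. intros Hno. apply Hinf. exists l. intros v. apply Hl.
  destruct (le_lt_dec (level v) n) as [H|H]; [exact H|]. exfalso.
  destruct (path_from_root v) as [p [_ [Hp _]]].
  apply Hno. exists (p n). apply Hp. lia.
Qed.

(** König's lemma: the ray follows vertices from which upward paths of every length start;
    [desc x m] is such a path of length [m], indexed by level. *)
Lemma exists_ray : infinite_type V -> exists R, ray R.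
Proof.
  intros Hinf.
  set (desc := fun x m => exists y p, level y = level x + m /\ p (level x) = x /\ p (level y) = y /\
     forall i, level x <= i < level y -> level (p i) = i /\ adj (p i) (p (S i))).
  assert (Hdesc : forall x m, desc x (S m) -> exists y, adj x y /\ level y = S (level x) /\ desc y m).
  { intros x m [y [p [H1 [H2 [H3 H4]]]]].
    assert (Hl : level (p (S (level x))) = S (level x)).
    { destruct m. - replace (S (level x)) with (level y) by lia. now rewrite H3.
      - apply H4. lia. }
    exists (p (S (level x))). repeat split.
    - destruct (H4 (level x)) as [_ H]; [lia|]. now rewrite H2 in H.
    - exact Hl.
    - exists y, p. rewrite Hl. repeat split; auto; try lia; apply H4; lia. }
  assert (Hmono : forall m x, desc x (S m) -> desc x m).
  { intros m x [y [p [H1 [H2 [H3 H4]]]]]. exists (p (level x + m)), p.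
    destruct (H4 (level x + m)) as [H5 _]; [lia|].
    rewrite H5. repeat split; auto; apply H4; lia. }
  assert (Hmono' : forall m m' x, m <= m' -> desc x m' -> desc x m).
  { intros m m' x H. induction H; auto. }
  destruct (dependent_choice (fun x => forall m, desc x m)
     (fun x y => adj x y /\ level y = S (level x)) r) as [R [HR0 HR]].
  - intros m. destruct (level_inhabited m Hinf) as [y Hy].
    destruct (path_from_root y) as [p [Hp1 [Hp2 Hp3]]].
    exists y, p. rewrite level_root. repeat split.
    + now rewrite Hy.
    + apply level_zero, Hp2. lia.
    + exact Hp1.
    + apply Hp2. lia.
    + apply Hp3. lia.
  - intros x Hx. destruct (deg x) as [l [_ [Hl _]]]. apply NNPP. intros Hno.
    (* If no child of [x] qualified, the lengths of upward paths would be bounded at each neighbour,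
       hence uniformly over the finite neighbourhood, against a longer path from [x]. *)
    destruct (uniform_bound (fun y m => ~ (level y = S (level x) /\ desc y m)) l) as [b Hb].
    + intros y Hy. apply NNPP. intros Hn. apply Hno. exists y.
      assert (Hall : forall m, level y = S (level x) /\ desc y m).
      { intros m. apply NNPP. intros Hm. apply Hn. exists m. intros m' Hm' [H1 H2].
        apply Hm. split; [exact H1|]. now apply (Hmono' m m'). }
      split; [apply Hall|]. split; [now apply Hl|apply (Hall 0)].
    + destruct (Hdesc x b (Hx (S b))) as [y [H1 H2]].
      apply (Hb y b); auto. now apply Hl.
  - exists R. intros n. split; [|apply HR].
    induction n as [|n IH]; [rewrite HR0; apply level_root|].
    destruct (HR n) as [_ [_ H]]. lia.
Qed.

End Levels.

(** * Colouring relative to a spine *)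

(** By extensionality equivalent elements have equal predicates [E x], so [epsilon] picks one
    enumeration for the whole class; [idx] is the position in it. *)
Lemma class_indexing {A : Type} (E : A -> A -> Prop) :
  (forall x y, E x y -> E y x) -> (forall x y z, E x y -> E y z -> E x z) ->
  (forall y, exists l, NoDup l /\ forall x, In x l <-> E y x) ->
  exists idx : A -> nat, forall y, exists l, NoDup l /\ (forall x, In x l <-> E y x) /\
    forall x, In x l -> nth_error l (idx x) = Some x.
Proof.
  intros Hsym Htrans Hfin.
  set (enum := fun P : A -> Prop => epsilon (inhabits (@nil A))
     (fun l => NoDup l /\ forall x, In x l <-> P x)).
  assert (Henum : forall y, NoDup (enum (E y)) /\ forall x, In x (enum (E y)) <-> E y x).
  { intros y. apply (epsilon_spec (inhabits (@nil A))
      (fun l => NoDup l /\ forall x, In x l <-> E y x)), Hfin. }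
  exists (fun x => epsilon (inhabits 0) (fun n => nth_error (enum (E x)) n = Some x)).
  intros y. exists (enum (E y)). split; [apply Henum|split; [apply Henum|]].
  intros x Hx. assert (Hyx : E y x) by now apply Henum.
  assert (Heq : E x = E y).
  { apply functional_extensionality. intros z. apply propositional_extensionality.
    split; eauto. }
  rewrite Heq. apply (epsilon_spec (inhabits 0) (fun n => nth_error (enum (E y)) n = Some x)).
  now apply In_nth_error.
Qed.

Lemma indexed_injective {A : Type} (l : list A) (idx : A -> nat) x y :
  nth_error l (idx x) = Some x -> nth_error l (idx y) = Some y -> idx x = idx y -> x = y.
Proof. congruence. Qed.

Lemma indexed_surjective {A : Type} (l : list A) (idx : A -> nat) n :
  NoDup l -> (forall x, In x l -> nth_error l (idx x) = Some x) -> n < length l ->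
  exists x, In x l /\ idx x = n.
Proof.
  intros Hl Hidx Hn. destruct (nth_error l n) as [x|] eqn:Hx.
  - exists x. assert (Hin : In x l) by (eapply nth_error_In; eauto). split; [exact Hin|].
    apply (proj1 (NoDup_nth_error l) Hl).
    + apply nth_error_Some. now rewrite Hidx.
    + now rewrite Hidx.
  - apply nth_error_None in Hx. lia.
Qed.

Definition twins {V : Type} (adj : V -> V -> Prop) (level : V -> nat) (D : V -> Prop)
    (y y' : V) : Prop :=
  ~ D y /\ ~ D y' /\ level y = level y' /\
  forall x, adj x y /\ (level x < level y \/ D x) <-> adj x y' /\ (level x < level y' \/ D x).

Definition inner_neighbour {V : Type} (adj : V -> V -> Prop) (D : V -> Prop) (y : V) : Prop :=
  exists d d1 d2, D d /\ D d1 /\ D d2 /\ d1 <> d2 /\ adj d d1 /\ adj d d2 /\ adj d y.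

(** [U] marks the vertices from which the top colour [k - 1] is withheld: none for a single ray, the
    off-spine neighbours of selected ray vertices for two rays. *)
Record spine_colouring {V : Type} (adj : V -> V -> Prop) (level : V -> nat) (k : nat)
    (D U : V -> Prop) (c : V -> nat) : Prop := {
  colour_bound : forall v, c v < k;
  colour_spine : forall v, D v -> c v = 0;
  colour_twins : forall y y', twins adj level D y y' -> c y = c y' -> y = y';
  colour_deviating : forall y, U y -> c y <> k - 1;
  colour_top : forall y, ~ D y -> ~ U y -> exists y', twins adj level D y y' /\ c y' = k - 1;
  colour_zero : forall y, ~ D y -> ~ U y -> c y = 0 ->
    exists l, NoDup l /\ length l = k /\ forall x, In x l <-> twins adj level D y x }.

Section Colouring.
Context {V : Type} (adj : V -> V -> Prop) (level : V -> nat) (r : V) (k : nat).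
Context (adj_sym : forall x y, adj x y -> adj y x).
Context (levels : rooted_levels adj level r).
Context (deg : forall v, degree_le adj (S k) v).
Context (D U : V -> Prop).
Context (D_root : D r) (D_next : exists d, D d /\ adj r d).
Context (U_spine : forall y, U y -> ~ D y).
Context (U_inner : forall y, U y -> inner_neighbour adj D y).
Context (U_twins : forall y y', U y -> twins adj level D y y' -> U y').

Notation twin := (twins adj level D).

Lemma twins_refl y : ~ D y -> twin y y.
Proof. unfold twins. tauto. Qed.

Lemma twins_sym y y' : twin y y' -> twin y' y.
Proof.
  intros (H1 & H2 & H3 & H4). repeat split; auto; try lia; apply H4; auto; split; auto.
Qed.

Lemma twins_trans y1 y2 y3 : twin y1 y2 -> twin y2 y3 -> twin y1 y3.
Proof.
  intros (H1 & H2 & H3 & H4) (G1 & G2 & G3 & G4).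
  split; [exact H1|split; [exact G2|split; [lia|]]]. intros x. now rewrite H4, G4.
Qed.

Lemma twins_spine_neighbour y y' d : twin y y' -> D d -> adj d y -> adj d y'.
Proof. intros (_ & _ & _ & H) Hd Hy. apply H. tauto. Qed.

Lemma twins_lower_neighbour y y' x : twin y y' -> adj x y -> level x < level y -> adj x y'.
Proof. intros (_ & _ & _ & H) Hd Hy. apply H. tauto. Qed.

Lemma off_spine_level y : ~ D y -> exists n, level y = S n.
Proof.
  intros Hy. destruct (level y) as [|n] eqn:E; [|eauto].
  exfalso. apply Hy. rewrite (level_zero adj level r levels y E). exact D_root.
Qed.

(** A parent [p] of [y] is adjacent to every twin of [y] and has a further neighbour: its own parent
    or, if [p] is the root, a spine vertex. *)
Lemma twins_count y l :
  ~ D y -> NoDup l -> (forall x, In x l -> twin y x) -> length l <= k.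
Proof.
  intros Hy Hl Htw. destruct (off_spine_level y Hy) as [n Hn].
  destruct (level_parent adj level r levels y n Hn) as [p [Hp Hpn]].
  assert (Hex : exists q, adj p q /\ ~ In q l).
  { destruct n as [|n].
    - apply (level_zero adj level r levels) in Hpn. subst p.
      destruct D_next as [q [Hq Hrq]]. exists q. split; [exact Hrq|].
      intros Hin. now apply Htw in Hin as (_ & H & _).
    - destruct (level_parent adj level r levels p n Hpn) as [q [Hq Hqn]].
      exists q. split; [now apply adj_sym|]. intros Hin.
      apply Htw in Hin as (_ & _ & H & _). lia. }
  destruct Hex as [q [Hpq Hq]].
  enough (length (q :: l) <= S k) by (simpl in *; lia).
  apply (neighbours_bound adj (S k) deg p); [now constructor|].
  intros w [<-|Hw]; [exact Hpq|].
  apply (twins_lower_neighbour y); auto. lia.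
Qed.

(** Two of the at most [S k] neighbours of [d] lie on [D], which leaves at most [k - 1] for the
    class. *)
Lemma twins_inner_count y l :
  inner_neighbour adj D y -> NoDup l -> (forall x, In x l -> twin y x) -> length l < k.
Proof.
  intros (d & d1 & d2 & Hd & H1 & H2 & Hne & A1 & A2 & Ay) Hl Htw.
  enough (length (d1 :: d2 :: l) <= S k) by (simpl in *; lia).
  assert (Hoff : forall w, In w l -> ~ D w) by (intros w Hw; now apply Htw in Hw as (_ & H & _)).
  apply (neighbours_bound adj (S k) deg d).
  - constructor; [|constructor; [|exact Hl]].
    + intros [E|Hin]; [now symmetry in E|now apply Hoff in Hin].
    + intros Hin. now apply Hoff in Hin.
  - intros w [<-|[<-|Hw]]; auto. apply (twins_spine_neighbour y); auto.
Qed.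

Lemma twins_finite y : exists l, NoDup l /\ forall x, In x l <-> twin y x.
Proof.
  destruct (classic (D y)) as [HD|HD].
  { exists []. split; [constructor|]. intros x. split; [intros []|]. now intros (H & _). }
  destruct (off_spine_level y HD) as [n Hn].
  destruct (level_parent adj level r levels y n Hn) as [p [Hp Hpn]].
  destruct (deg p) as [l [Hl [Hin _]]].
  exists (filter (fun x => if excluded_middle_informative (twin y x) then true else false) l).
  split; [now apply NoDup_filter|]. intros x. rewrite filter_In.
  destruct (excluded_middle_informative (twin y x)) as [H|H].
  - split; [tauto|]. intros _. split; [|reflexivity]. apply Hin.
    apply (twins_lower_neighbour y); auto. lia.
  - split; [now intros [_ ?]|tauto].
Qed.

(** Classes are indexed from 0. A full class uses all colours; a class in [U] is smaller and takes
    the index itself, missing [k - 1]; any other class takes [k - 1 - idx], missing 0 but attaining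
    [k - 1]. *)
Lemma exists_spine_colouring : 2 <= k -> exists c, spine_colouring adj level k D U c.
Proof.
  intros Hk.
  destruct (class_indexing twin twins_sym twins_trans twins_finite) as [idx Hidx].
  set (full := fun y => exists l, NoDup l /\ length l = k /\ forall x, In x l <-> twin y x).
  assert (Hfull : forall y y', full y -> twin y y' -> full y').
  { intros y y' [l [H1 [H2 H3]]] Hy. exists l. split; [exact H1|split; [exact H2|]]. intros x. split.
    - intros Hx. apply (twins_trans y' y); [now apply twins_sym|now apply H3].
    - intros Hx. apply H3. now apply (twins_trans y y'). }
  set (c := fun y => if excluded_middle_informative (D y) then 0 else
    if excluded_middle_informative (full y \/ U y) then idx y else k - 1 - idx y).
  assert (Hlt : forall y, ~ D y -> idx y < k /\ (~ full y -> idx y < k - 1)).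
  { intros y Hy. destruct (Hidx y) as [l [H1 [H2 H3]]].
    assert (Hin : In y l) by now apply H2, twins_refl.
    assert (idx y < length l) by (apply nth_error_Some; now rewrite H3).
    assert (length l <= k) by (apply (twins_count y); auto; intros x; apply H2).
    split; [lia|]. intros Hf. enough (length l <> k) by lia.
    intros E. apply Hf. now exists l. }
  assert (HUf : forall y, U y -> ~ full y).
  { intros y Hy [l [H1 [H2 H3]]].
    assert (length l < k) by (apply (twins_inner_count y); auto; intros x; apply H3). lia. }
  exists c. split.
  - intros v. unfold c. destruct (excluded_middle_informative (D v)) as [H|H]; [lia|].
    destruct (Hlt v H).
    destruct (excluded_middle_informative (full v \/ U v)); lia.
  - intros v Hv. unfold c. now destruct (excluded_middle_informative (D v)).
  - intros y y' Ht Hc. pose proof Ht as (H1 & H2 & _).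
    destruct (Hidx y) as [l [L1 [L2 L3]]].
    apply (indexed_injective l idx); [apply L3, L2, twins_refl; auto|now apply L3, L2|].
    unfold c in Hc.
    destruct (excluded_middle_informative (D y)); [easy|].
    destruct (excluded_middle_informative (D y')); [easy|].
    destruct (Hlt y H1) as [B1 B2]. destruct (Hlt y' H2) as [B1' B2'].
    destruct (excluded_middle_informative (full y \/ U y)) as [F|F];
    destruct (excluded_middle_informative (full y' \/ U y')) as [F'|F']; auto.
    + exfalso. apply F'. destruct F; [left; now apply (Hfull y)|right; now apply (U_twins y)].
    + exfalso. apply F. apply twins_sym in Ht.
      destruct F'; [left; now apply (Hfull y')|right; now apply (U_twins y')].
    + assert (idx y < k - 1) by (apply B2; tauto).
      assert (idx y' < k - 1) by (apply B2'; tauto). lia.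
  - intros y Hy. unfold c. pose proof (U_spine y Hy).
    destruct (excluded_middle_informative (D y)); [easy|].
    destruct (excluded_middle_informative (full y \/ U y)) as [_|F]; [|tauto].
    destruct (Hlt y) as [_ B]; auto. specialize (B (HUf y Hy)). lia.
  - intros y HD HU. destruct (Hidx y) as [l [L1 [L2 L3]]].
    assert (Hin : In y l) by now apply L2, twins_refl.
    (* The index that receives colour [k - 1] in the class of [y]. *)
    set (n := if excluded_middle_informative (full y) then k - 1 else 0).
    assert (Hn : n < length l).
    { unfold n. destruct (excluded_middle_informative (full y)) as [[l' [M1 [M2 M3]]]|_].
      - assert (length l' <= length l).
        { apply NoDup_incl_length; [exact M1|]. intros x Hx. now apply L2, M3. }
        lia.
      - destruct l; [easy|simpl; lia]. }
    destruct (indexed_surjective l idx n L1 L3 Hn) as [y' [Hy' Hi]].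
    apply L2 in Hy'. exists y'. split; [exact Hy'|]. unfold c. rewrite Hi. unfold n.
    pose proof Hy' as (_ & HD' & _).
    destruct (excluded_middle_informative (D y')); [easy|].
    destruct (excluded_middle_informative (full y' \/ U y')) as [F|F];
    destruct (excluded_middle_informative (full y)) as [F'|F']; try lia.
    + exfalso. apply twins_sym in Hy'. destruct F as [F|F].
      * now apply F', (Hfull y').
      * now apply HU, (U_twins y').
    + exfalso. apply F. left. now apply (Hfull y).
  - intros y HD HU. unfold c.
    destruct (excluded_middle_informative (D y)); [easy|].
    destruct (excluded_middle_informative (full y \/ U y)) as [[F|F]|F]; [auto|easy|].
    intros E. destruct (Hlt y HD) as [_ B].
    assert (idx y < k - 1) by (apply B; tauto). lia.
Qed.

Lemma inner_neighbour_colour c y :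
  spine_colouring adj level k D U c -> ~ D y -> ~ U y -> inner_neighbour adj D y -> c y <> 0.
Proof.
  intros Hc HD HU Hin H0. destruct (colour_zero _ _ _ _ _ _ Hc y HD HU H0) as [l [H1 [H2 H3]]].
  assert (length l < k) by (apply (twins_inner_count y); auto; intros x; apply H3). lia.
Qed.

Lemma spine_rigid c g :
  spine_colouring adj level k D U c -> automorphism adj g -> (forall v, c (g v) = c v) ->
  (forall v, D v -> g v = v) -> forall v, g v = v.
Proof.
  intros Hc Hg Hgc HD.
  assert (Hlev : forall v, level (g v) = level v).
  { intros v. apply (automorphism_level_fixed adj level r levels); auto. }
  enough (H : forall n v, level v < n -> g v = v) by (intros v; apply (H (S (level v))); lia).
  induction n as [|n IH]; intros v Hv; [lia|].
  destruct (classic (D v)) as [HDv|HDv]; [auto|].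
  (* All lower vertices and all of [D] are fixed, so [g v] and [v] are twins of equal colour. *)
  apply (colour_twins _ _ _ _ _ _ Hc); [|apply Hgc].
  assert (Hfix : forall x, level x < level v \/ D x -> g x = x).
  { intros x [Hx|Hx]; [apply IH; lia|auto]. }
  split; [|split; [exact HDv|split; [apply Hlev|]]].
  - intros Hd. apply HDv. apply HD in Hd as Hd'.
    apply (automorphism_injective adj) in Hd'; [|exact Hg]. now rewrite <- Hd'.
  - intros x. rewrite Hlev. destruct Hg as [_ Hadj]. split; intros [Hx Hl]; split; auto.
    + apply Hadj. now rewrite (Hfix x Hl).
    + apply Hadj in Hx. now rewrite (Hfix x Hl) in Hx.
Qed.
End Colouring.

(** * Walks through colour 0 *)

(* Indices start at [S n] so that the vertex has a predecessor on the ray. *)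
Definition tree_like_from {V : Type} (adj : V -> V -> Prop) (level : V -> nat)
    (R : nat -> V) (N : nat) : Prop :=
  forall n, N <= n ->
    (forall y, adj (R (S n)) y -> y = R n \/
       (level y = S (S n) /\ forall z, adj z y -> level z < level y -> z = R (S n))) /\
    exists y, adj (R (S n)) y /\ y <> R n /\ y <> R (S (S n)).

Section Runs.
Context {V : Type} (adj : V -> V -> Prop) (level : V -> nat) (r : V) (k : nat).
Context (adj_sym : forall x y, adj x y -> adj y x).
Context (levels : rooted_levels adj level r).
Context (deg : forall v, degree_le adj (S k) v).

(** The [k] twins of [Q (S (S j))] and the vertex [Q j] exhaust the neighbours of [Q (S j)]. So
    every other neighbour has the same lower neighbours as [Q (S (S j))], of which there is only
    one, and [2 <= k] gives a branch off the walk. *)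
Lemma full_run_tree_like (D : V -> Prop) (Q R : nat -> V) M :
  2 <= k -> (forall j, level (Q j) = M + j /\ adj (Q j) (Q (S j))) ->
  (forall j, R (M + j) = Q j) ->
  (forall j, exists l, NoDup l /\ length l = k /\
     forall x, In x l <-> twins adj level D (Q (S j)) x) ->
  tree_like_from adj level R M.
Proof.
  intros Hk HQ HR Hfull.
  assert (Hnb : forall j y, adj (Q (S j)) y -> y = Q j \/ twins adj level D (Q (S (S j))) y).
  { intros j y Hy. destruct (Hfull (S j)) as [l [H1 [H2 H3]]].
    assert (Hin : In y (Q j :: l)).
    { apply (neighbours_exhausted adj (S k) deg (Q (S j))); [..|exact Hy].
      - constructor; [|exact H1]. intros Hin. apply H3 in Hin as (_ & _ & Hl & _).
        destruct (HQ j), (HQ (S (S j))). lia.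
      - intros x [<-|Hx]; [apply adj_sym, HQ|]. apply H3 in Hx.
        apply (twins_lower_neighbour adj level D (Q (S (S j)))); [exact Hx|apply HQ|].
        destruct (HQ (S j)), (HQ (S (S j))). lia.
      - simpl. lia. }
    destruct Hin as [<-|Hin]; [now left|right; now apply H3]. }
  assert (Hlow : forall j z, adj z (Q (S j)) -> level z < level (Q (S j)) -> z = Q j).
  { intros j z Hz Hl. destruct (Hnb j z) as [E|(_ & _ & H & _)]; auto.
    destruct (HQ (S j)), (HQ (S (S j))). lia. }
  intros n Hn. replace n with (M + (n - M)) by lia. set (j := n - M).
  replace (S (M + j)) with (M + S j) by lia. replace (S (M + S j)) with (M + S (S j)) by lia.
  rewrite !HR. split.
  - intros y Hy. destruct (Hnb j y Hy) as [E|Ht]; [now left|right].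
    pose proof Ht as (_ & _ & Hl & Ht'). destruct (HQ (S (S j))) as [HL _].
    split; [lia|]. intros z Hz Hzl. apply Hlow; [|lia].
    apply (twins_sym adj level D) in Ht.
    now apply (twins_lower_neighbour adj level D y).
  - destruct (Hfull (S j)) as [l [H1 [H2 H3]]].
    destruct l as [|a [|b l]]; simpl in H2; try lia.
    assert (Hc : exists y, In y (a :: b :: l) /\ y <> Q (S (S j))).
    { destruct (classic (a = Q (S (S j)))) as [E|E].
      - exists b. split; [simpl; tauto|]. intros E'. inversion H1 as [|? ? Hna _]. subst.
        apply Hna. left. congruence.
      - exists a. split; [simpl; tauto|exact E]. }
    destruct Hc as [y [Hy Hne]]. apply H3 in Hy. exists y. repeat split; [..|exact Hne].
    + apply (twins_lower_neighbour adj level D (Q (S (S j)))); [exact Hy|apply HQ|].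
      destruct (HQ (S j)), (HQ (S (S j))). lia.
    + intros ->. destruct Hy as (_ & _ & Hl & _). destruct (HQ j), (HQ (S (S j))). lia.
Qed.

Lemma tree_like_unique_lower R N n z :
  ray adj level R -> tree_like_from adj level R N -> N <= n ->
  adj z (R (S (S n))) -> level z < S (S n) -> z = R (S n).
Proof.
  intros HR HT Hn Hz Hl. destruct (HT n Hn) as [H _].
  destruct (H (R (S (S n))) (ray_adj adj level R (S n) HR)) as [E|[H1 H2]].
  - pose proof (ray_level adj level R n HR). pose proof (ray_level adj level R (S (S n)) HR).
    rewrite E in *. lia.
  - apply H2; [exact Hz|]. lia.
Qed.

Section Coloured.
Context (D U : V -> Prop) (c : V -> nat).
Context (colouring : spine_colouring adj level k D U c).
Context (U_lower : forall y z, U y -> adj z y -> level z < level y -> D z).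

Lemma off_spine_top_neighbour x y :
  ~ D x -> ~ D y -> adj x y -> level x < level y -> exists y', adj x y' /\ c y' = k - 1.
Proof.
  intros Hx Hy Hxy Hl.
  destruct (colour_top _ _ _ _ _ _ colouring y Hy) as [y' [Ht Hc]].
  - intros HU. now apply Hx, (U_lower y x).
  - exists y'. split; [|exact Hc]. now apply (twins_lower_neighbour adj level D y).
Qed.

(* Once an upward walk through colour 0 has left the spine, it stays off it, and each
   step goes into a class of [k] twins. *)
Lemma zero_run_dichotomy (Q : nat -> V) M L :
  2 <= k ->
  (forall x d, L <= level x -> ~ D x -> c x = 0 -> D d -> adj x d -> level d = S (level x) ->
     False) ->
  (forall j, level (Q j) = M + j /\ adj (Q j) (Q (S j))) -> (forall j, c (Q j) = 0) ->
  (exists J, forall j, J <= j -> D (Q j)) \/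
  (exists J R N, ray adj level R /\ tree_like_from adj level R N /\
     forall j, J <= j -> R (M + j) = Q j /\ ~ D (Q j)).
Proof.
  intros Hk Hret HQ H0.
  destruct (classic (exists J, L <= J /\ ~ D (Q J))) as [[J [HJ HDJ]]|Hno].
  2:{ left. exists L. intros j Hj. apply NNPP. intros Hn. apply Hno. eauto. }
  right.
  assert (Hoff : forall j, J <= j -> ~ D (Q j)).
  { intros j Hj. induction Hj as [|j Hj IH]; [exact HDJ|]. intros HD.
    destruct (HQ j) as [L1 A]. destruct (HQ (S j)) as [L2 _].
    apply (Hret (Q j) (Q (S j))); auto; lia. }
  destruct (ray_through adj level r levels (fun j => Q (J + j)) (M + J)) as [R [HR HRQ]].
  { intros j. destruct (HQ (J + j)) as [L1 A]. split; [lia|].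
    now replace (J + S j) with (S (J + j)) by lia. }
  exists J, R, (M + J). split; [exact HR|split].
  - apply (full_run_tree_like D (fun j => Q (J + j)) R _ Hk).
    + intros j. destruct (HQ (J + j)) as [L1 A]. split; [lia|].
      now replace (J + S j) with (S (J + j)) by lia.
    + exact HRQ.
    + intros j. apply (colour_zero _ _ _ _ _ _ colouring); [apply Hoff; lia| |apply H0].
      intros HU. destruct (HQ (J + j)) as [L1 A]. destruct (HQ (S (J + j))) as [L2 _].
      replace (J + S j) with (S (J + j)) in HU by lia.
      apply (Hoff (J + j)); [lia|]. apply (U_lower _ _ HU A). lia.
  - intros j Hj. split; [|now apply Hoff].
    specialize (HRQ (j - J)). replace (M + J + (j - J)) with (M + j) in HRQ by lia.
    rewrite HRQ. f_equal. lia.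
Qed.

End Coloured.

End Runs.

(** * At most one tree-like ray *)

Section SingleRay.
Context {V : Type} (adj : V -> V -> Prop) (level : V -> nat) (r : V) (k : nat).
Context (adj_sym : forall x y, adj x y -> adj y x) (adj_irrefl : forall x, ~ adj x x).
Context (levels : rooted_levels adj level r).
Context (deg : forall v, degree_le adj (S k) v).
Context (k_ge2 : 2 <= k).
Context (R : nat -> V) (R_ray : ray adj level R).
Context (R_only : forall T N, ray adj level T -> tree_like_from adj level T N ->
  eventually_equal T R).

Notation on_ray := (fun x => exists n, x = R n).
Notation nowhere := (fun _ : V => False).

Context (c : V -> nat) (colouring : spine_colouring adj level k on_ray nowhere c).

Lemma level_R n : level (R n) = n.
Proof. apply R_ray. Qed.

Lemma adj_R n : adj (R n) (R (S n)).
Proof. apply R_ray. Qed.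

Lemma off_ray_colour n y : ~ on_ray y -> adj (R (S n)) y -> c y <> 0.
Proof.
  intros Hy Hadj.
  apply (inner_neighbour_colour adj level k deg on_ray nowhere); auto.
  exists (R (S n)), (R n), (R (S (S n))). repeat split; eauto.
  - intros E. apply (f_equal level) in E. rewrite !level_R in E. lia.
  - apply adj_sym, adj_R.
  - apply adj_R.
Qed.

(** A walk that left the ray for good would follow a tree-like ray, which by [R_only] shares a tail
    with [R]. *)
Lemma zero_run_on_ray (Q : nat -> V) M :
  (forall j, level (Q j) = M + j /\ adj (Q j) (Q (S j))) -> (forall j, c (Q j) = 0) ->
  exists J, forall j, J <= j -> Q j = R (M + j).
Proof.
  intros HQ H0.
  destruct (zero_run_dichotomy adj level r k adj_sym levels deg on_ray nowhere c
    colouring) with (Q := Q) (M := M) (L := 0) as [[J HJ]|(J & T & N & HT & Htl & HJ)]; auto.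
  - easy.
  - intros x d _ Hx Hc [n ->] Hxd Hl. rewrite level_R in Hl. subst n.
    apply (off_ray_colour (level x) x); auto.
  - exists J. intros j Hj. destruct (HJ j Hj) as [n E]. destruct (HQ j) as [Hl _].
    rewrite E, level_R in Hl. now subst n.
  - destruct (R_only T N HT Htl) as [N' HN']. exfalso.
    destruct (HJ (J + N')) as [E HD]; [lia|]. apply HD. exists (M + (J + N')).
    rewrite <- E. apply HN'. lia.
Qed.

(* Pulling the tail of the ray back along the shift produces an upward walk through colour 0
   that would have to rejoin the ray. *)
Lemma no_shift g N t :
  automorphism adj g -> (forall v, c (g v) = c v) ->
  ~ (forall j, g (R (N + j)) = R (N + S t + j)).
Proof.
  intros Hg Hc Hs. destruct (automorphism_inverse adj g Hg) as [h [Hh [Hhg Hgh]]].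
  assert (Hiter : forall i j, Nat.iter i g (R (N + j)) = R (N + i * S t + j)).
  { induction i as [|i IH]; intros j; simpl; [f_equal; lia|].
    rewrite IH. replace (N + i * S t + j) with (N + (i * S t + j)) by lia.
    rewrite Hs. f_equal. lia. }
  assert (Hgih : forall i x, Nat.iter i g (Nat.iter i h x) = x).
  { induction i as [|i IH]; intros x; [reflexivity|].
    rewrite Nat.iter_succ_r. simpl. now rewrite Hgh. }
  assert (Hch : forall i x, c (Nat.iter i h x) = c x).
  { induction i as [|i IH]; intros x; [reflexivity|].
    simpl. now rewrite <- (IH x), <- (Hc (h _)), Hgh. }
  (* Formally [Z i] has index [N + i * t - i * S t = N - i]: it extends the ray backwards, whence
     consecutive terms are adjacent. *)
  set (Z := fun i => Nat.iter i h (R (N + i * t))).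
  assert (HZadj : forall i, adj (Z i) (Z (S i))).
  { intros i. unfold Z. rewrite Nat.iter_succ_r.
    apply (proj1 (proj2 (automorphism_iter adj h i Hh) _ _)).
    rewrite <- (Hhg (R (N + i * t))). apply (proj1 (proj2 Hh _ _)).
    rewrite Hs. replace (N + S t + i * t) with (S (N + S i * t)) by lia.
    apply adj_sym, adj_R. }
  assert (HZ0 : forall i, c (Z i) = 0).
  { intros i. unfold Z. rewrite Hch. apply (colour_spine _ _ _ _ _ _ colouring). eauto. }
  destruct (slope_one_eventually (fun i => level (Z i)) N) as [K HK].
  - intros i. apply (level_step adj level r levels), HZadj.
  (* Both estimates compare with [level (Nat.iter i g r)]: it is at least [i * S t] and at most
     [N + i * t + level (Z i)], so [i <= level (Z i) + N]. *)
  - intros i. pose proof (automorphism_iter adj g i Hg) as Hgi.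
    pose proof (automorphism_level_le adj level r levels _ (R (N + 0)) Hgi) as H1.
    pose proof (automorphism_level_ge adj level r adj_sym levels _ (Z i) Hgi) as H2.
    unfold Z in H2 at 1. rewrite Hgih, level_R in H2. rewrite Hiter, !level_R in H1. nia.
  - pose proof (slope_one_run (fun i => level (Z i)) K HK) as HL. simpl in HL.
    destruct (zero_run_on_ray (fun j => Z (K + j)) (level (Z K))) as [J HJ].
    + intros j. split; [apply HL|]. rewrite Nat.add_succ_r. apply HZadj.
    + intros j. apply HZ0.
    (* The summand [N] brings the index into the range of the shift. After [i] applications of [g]
       one side is at [N + i * t], the other beyond [N + i * S t]. *)
    + specialize (HJ (S J + N) ltac:(lia)). set (i := K + (S J + N)) in *.
      apply (f_equal (Nat.iter i g)) in HJ. unfold Z at 1 in HJ. rewrite Hgih in HJ.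
      replace (level (Z K) + (S J + N)) with (N + (level (Z K) + S J)) in HJ by lia.
      rewrite Hiter in HJ. apply (f_equal level) in HJ. rewrite !level_R in HJ.
      nia.
Qed.

(** Descending one step, the image of [R N] has colour 0 and is adjacent to [R (S N)], so it is on
    the ray. Injectivity excludes indices above [N], adjacency those below. *)
Lemma fixes_tail_fixes_ray g N :
  automorphism adj g -> (forall v, c (g v) = c v) -> fixes_from g R N ->
  forall n, g (R n) = R n.
Proof.
  intros Hg Hc. induction N as [|N IH]; intros HN.
  { intros n. apply HN. lia. }
  apply IH. intros i Hi. destruct (Nat.eq_dec i N) as [->|Hne]; [|apply HN; lia].
  assert (Hadj : adj (R (S N)) (g (R N))).
  { rewrite <- (HN (S N)) by lia. apply (proj1 (proj2 Hg _ _)), adj_sym, adj_R. }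
  destruct (classic (on_ray (g (R N)))) as [[m Hm]|Hoff].
  2:{ exfalso. apply (off_ray_colour N _ Hoff Hadj). rewrite Hc.
      apply (colour_spine _ _ _ _ _ _ colouring). eauto. }
  rewrite Hm. f_equal.
  assert (~ N < m).
  { intros Hlt. rewrite <- (HN m) in Hm by lia.
    apply (automorphism_injective adj) in Hm; [|exact Hg].
    apply (f_equal level) in Hm. rewrite !level_R in Hm. lia. }
  rewrite Hm in Hadj. apply adj_sym, (level_step adj level r levels) in Hadj.
  rewrite !level_R in Hadj. lia.
Qed.

Lemma single_ray_distinguishing : distinguishing_colouring adj k c.
Proof.
  split; [apply (colour_bound _ _ _ _ _ _ colouring)|].
  intros g Hg Hc.
  apply (spine_rigid adj level r k levels on_ray nowhere) with (c := c); auto.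
  { exists 0. symmetry. now apply (ray_root adj level r levels). }
  destruct (automorphism_ray_level adj level r levels g R Hg R_ray) as [N HN].
  pose proof (slope_one_run (fun n => level (g (R n))) N HN) as HL. simpl in HL.
  destruct (zero_run_on_ray (fun j => g (R (N + j))) (level (g (R N)))) as [J HJ].
  { intros j. split; [apply HL|]. rewrite Nat.add_succ_r.
    apply (proj1 (proj2 Hg _ _)), adj_R. }
  { intros j. rewrite Hc. apply (colour_spine _ _ _ _ _ _ colouring). eauto. }
  set (M := level (g (R N))) in *.
  (* The tail is shifted by [M - N]; a nonzero shift contradicts [no_shift] for [g] or for its
     inverse. The extra [- 1] matches the shift [S t] there. *)
  destruct (lt_eq_lt_dec N M) as [[Hlt|E]|Hgt].
  - exfalso. apply (no_shift g (N + J) (M - N - 1) Hg Hc). intros j.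
    rewrite <- Nat.add_assoc, HJ by lia. f_equal. lia.
  - intros v [n ->]. apply (fixes_tail_fixes_ray g (N + J)); auto.
    intros i Hi. replace i with (N + (i - N)) at 1 by lia. rewrite HJ by lia. f_equal. lia.
  - exfalso. destruct (automorphism_inverse adj g Hg) as [h [Hh [Hhg Hgh]]].
    apply (no_shift h (M + J) (N - M - 1) Hh).
    + intros v. now rewrite <- (Hc (h v)), Hgh.
    + intros j. rewrite <- Nat.add_assoc, <- HJ by lia. rewrite Hhg. f_equal. lia.
Qed.
End SingleRay.

(** * Two tree-like rays *)

(** [P n m] will say that an automorphism fixing one ray from [n] and the other from [S m] also
    fixes vertex [m] of the latter; hence the comparison with [S m]. Doubling makes a term
    recognisable up to a bounded shift. *)
Lemma exists_sparse_sequence (P : nat -> nat -> Prop) (N : nat) :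
  (forall n, exists B, forall m, B <= m -> P n m) ->
  exists a : nat -> nat, N <= a 0 /\
    (forall n m, n <= N -> a 0 <= S m -> P n m) /\
    forall i, 2 * a i < a (S i) /\ forall n m, n <= a i -> a (S i) <= S m -> P n m.
Proof.
  intros HP.
  assert (Hnext : forall n, exists b, 2 * n < b /\ forall n' m, n' <= n -> b <= S m -> P n' m).
  { intros n. destruct (uniform_bound P (seq 0 (S n))) as [b Hb]; [auto|].
    exists (2 * n + 2 + b). split; [lia|]. intros n' m Hn' Hm.
    apply Hb; [apply in_seq; lia|lia]. }
  destruct (Hnext N) as [b [Hb1 Hb2]].
  destruct (dependent_choice (fun _ => True) (fun n b => 2 * n < b /\
    forall n' m, n' <= n -> b <= S m -> P n' m) b) as [a [Ha0 Ha]]; auto.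
  { intros n _. destruct (Hnext n) as [b' Hb']. eauto. }
  exists a. rewrite Ha0. split; [lia|split; [exact Hb2|]]. intros i. apply Ha.
Qed.

(* Induction on [n]: two automorphisms sending [R n] to the same neighbour of [R (S n)] differ
   by one that fixes [R n] too, and [R (S n)] has finitely many neighbours. *)
Lemma fixing_both_ends_bound {V : Type} (adj : V -> V -> Prop) (level : V -> nat) (r : V)
    (d : nat) (R T : nat -> V) (N : nat) :
  rooted_levels adj level r -> (forall v, degree_le adj d v) ->
  (forall x y, adj x y -> adj y x) ->
  ray adj level R -> ray adj level T -> tree_like_from adj level T N ->
  forall n, exists B, forall m, B <= m -> forall g, automorphism adj g ->
    fixes_from g R n -> fixes_from g T (S m) -> g (T m) = T m.
Proof.
  intros levels deg adj_sym HR HT Htl. induction n as [|n [B HB]].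
  (* Here the root is fixed, so levels are preserved and [T m] goes to the unique lower neighbour of
     [T (S m)]. *)
  - exists (S N). intros m Hm g Hg HgR HgT. destruct m as [|m]; [lia|].
    assert (Hr : g r = r).
    { rewrite <- (ray_root adj level r levels R HR). apply HgR. lia. }
    apply (tree_like_unique_lower adj level T N m); auto; [lia| |].
    + rewrite <- (HgT (S (S m))) by lia. apply (proj1 (proj2 Hg _ _)), HT.
    + rewrite (automorphism_level_fixed adj level r levels g _ Hg Hr).
      rewrite (ray_level adj level T _ HT). lia.
  - destruct (deg (R (S n))) as [l [_ [Hl _]]].
    destruct (uniform_bound (fun x m => forall g, automorphism adj g ->
      fixes_from g R (S n) -> fixes_from g T (S m) -> g (R n) = x -> g (T m) = T m) l)
      as [b Hb].
    + intros x _.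
      destruct (classic (exists m g, automorphism adj g /\ fixes_from g R (S n) /\
        fixes_from g T (S m) /\ g (R n) = x)) as [(m1 & g1 & H1 & H2 & H3 & H4)|Hno].
      2:{ exists 0. intros m _ g Hg HgR HgT Hx. exfalso. apply Hno. eauto 6. }
      destruct (automorphism_inverse adj g1 H1) as [h [Hh [Hhg _]]].
      (* One witness [g1] serves for all [g] with the same [x]. From [S m1] on it fixes [T], so the
         composite of [g] with its inverse falls under the induction hypothesis. *)
      exists (S m1 + B). intros m Hm g Hg HgR HgT Hx.
      assert (Hfix : h (g (T m)) = T m).
      { apply (HB m ltac:(lia) (fun y => h (g y))).
        - now apply automorphism_compose.
        - intros i Hi. destruct (Nat.eq_dec i n) as [->|Hne].
          + now rewrite Hx, <- H4, Hhg.
          + rewrite (HgR i) by lia. rewrite <- (H2 i) at 1 by lia. apply Hhg.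
        - intros i Hi. rewrite (HgT i) by lia. rewrite <- (H3 i) at 1 by lia. apply Hhg. }
      apply (automorphism_injective adj h); [exact Hh|]. rewrite Hfix.
      rewrite <- (H3 m) at 2 by lia. symmetry. apply Hhg.
    + exists b. intros m Hm g Hg HgR HgT. apply (Hb (g (R n)) m); auto.
      apply Hl. rewrite <- (HgR (S n)) by lia. apply (proj1 (proj2 Hg _ _)), adj_sym, HR.
Qed.

Section TwoRays.
Context {V : Type} (adj : V -> V -> Prop) (level : V -> nat) (r : V) (k : nat).
Context (adj_sym : forall x y, adj x y -> adj y x) (adj_irrefl : forall x, ~ adj x x).
Context (levels : rooted_levels adj level r).
Context (deg : forall v, degree_le adj (S k) v).
Context (k_ge2 : 2 <= k).
Context (R : bool -> nat -> V) (R_ray : forall b, ray adj level (R b)).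
Context (N0 : nat) (R_tree : forall b, tree_like_from adj level (R b) N0).
Context (R_disjoint : forall n, N0 <= n -> R true n <> R false n).
Context (a : nat -> nat) (a_start : N0 + 4 <= a 0) (a_gap : forall i, 2 * a i < a (S i)).

(* The second ray joins the spine only where it is tree-like; there, no edge joins the two
   rays. *)
Definition spine (x : V) : Prop :=
  (exists n, x = R true n) \/ (exists n, N0 + 2 <= n /\ x = R false n).

Definition selected (b : bool) (n : nat) : Prop :=
  exists i, n = a (2 * i + if b then 0 else 1).

Definition deviating (y : V) : Prop :=
  ~ spine y /\ exists b n, selected b n /\ adj (R b n) y.

Lemma a_increasing i j : i < j -> 2 * a i < a j.
Proof.
  intros H. induction H as [|j H IH]; [apply a_gap|]. pose proof (a_gap j). lia.
Qed.

Lemma a_ge i : a 0 + i <= a i.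
Proof. induction i as [|i IH]; [lia|]. pose proof (a_gap i). lia. Qed.

Lemma selected_ge b n : selected b n -> N0 + 4 <= n.
Proof. intros [i ->]. pose proof (a_ge (2 * i + if b then 0 else 1)). lia. Qed.

Lemma level_Rb b n : level (R b n) = n.
Proof. apply R_ray. Qed.

Lemma adj_Rb b n : adj (R b n) (R b (S n)).
Proof. apply R_ray. Qed.

Lemma Rb_index b b' n n' : N0 <= n -> R b n = R b' n' -> b = b' /\ n = n'.
Proof.
  intros Hn E. assert (n = n') by (apply (f_equal level) in E; now rewrite !level_Rb in E).
  subst n'. split; [|reflexivity]. destruct b, b'; auto; exfalso.
  - now apply (R_disjoint n).
  - now apply (R_disjoint n).
Qed.

Lemma spine_Rb b n : N0 + 2 <= n -> spine (R b n).
Proof. intros H. destruct b; [left|right]; eauto. Qed.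

Lemma spine_cases x :
  spine x -> exists b, x = R b (level x) /\ (b = true \/ N0 + 2 <= level x).
Proof.
  intros [[n ->]|[n [Hn ->]]]; rewrite level_Rb; [exists true|exists false]; auto.
Qed.

Lemma Rb_neighbour b n y :
  N0 <= n -> adj (R b (S n)) y -> y = R b n \/
    (level y = S (S n) /\ forall z, adj z y -> level z < level y -> z = R b (S n)).
Proof. intros Hn. apply (R_tree b n Hn). Qed.

Lemma Rb_unique_lower b n z :
  N0 <= n -> adj z (R b (S (S n))) -> level z < S (S n) -> z = R b (S n).
Proof.
  intros Hn. apply (tree_like_unique_lower adj level (R b) N0 n z); auto.
Qed.

Lemma Rb_inner b n y :
  (b = true \/ N0 + 2 <= n) -> adj (R b (S n)) y -> inner_neighbour adj spine y.
Proof.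
  intros Hb Hy.
  assert (Hs : forall i, n <= i -> spine (R b i)).
  { intros i Hi. destruct b; [left; eauto|]. right. exists i. split; [|reflexivity].
    destruct Hb; [discriminate|lia]. }
  exists (R b (S n)), (R b n), (R b (S (S n))). repeat split; auto.
  - intros E. apply (f_equal level) in E. rewrite !level_Rb in E. lia.
  - apply adj_sym, adj_Rb.
  - apply adj_Rb.
Qed.

Lemma deviating_unique_lower y b n :
  ~ spine y -> selected b n -> adj (R b n) y ->
  level y = S n /\ forall z, adj z y -> level z < level y -> z = R b n.
Proof.
  intros Hy Hs Hadj. apply selected_ge in Hs. destruct n as [|n]; [lia|].
  destruct (Rb_neighbour b n y) as [->|H]; [lia|exact Hadj| |exact H].
  exfalso. apply Hy, spine_Rb. lia.
Qed.

Lemma deviating_lower y z : deviating y -> adj z y -> level z < level y -> spine z.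
Proof.
  intros [Hy [b [n [Hs Hadj]]]] Hz Hl.
  rewrite (proj2 (deviating_unique_lower y b n Hy Hs Hadj) z Hz Hl).
  apply spine_Rb. apply selected_ge in Hs. lia.
Qed.

Lemma deviating_inner y : deviating y -> inner_neighbour adj spine y.
Proof.
  intros [Hy [b [n [Hs Hadj]]]]. apply selected_ge in Hs. destruct n as [|n]; [lia|].
  apply (Rb_inner b n); [right; lia|exact Hadj].
Qed.

Lemma deviating_twins y y' : deviating y -> twins adj level spine y y' -> deviating y'.
Proof.
  intros [Hy [b [n [Hs Hadj]]]] Ht. pose proof Ht as (_ & Hy' & _). split; [exact Hy'|].
  exists b, n. split; [exact Hs|].
  apply (twins_spine_neighbour adj level spine y y'); auto.
  apply spine_Rb. apply selected_ge in Hs. lia.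
Qed.

Lemma exists_two_ray_colouring :
  exists c, spine_colouring adj level k spine deviating c.
Proof.
  pose proof (fun b => ray_root adj level r levels (R b) (R_ray b)) as Hroot.
  apply (exists_spine_colouring adj level r k); auto.
  - left. exists 0. now rewrite Hroot.
  - exists (R true 1). split; [left; eauto|]. rewrite <- (Hroot true). apply adj_Rb.
  - now intros y [H _].
  - apply deviating_inner.
  - apply deviating_twins.
Qed.

Context (c : V -> nat) (colouring : spine_colouring adj level k spine deviating c).

Lemma selected_no_top b n y : selected b n -> adj (R b n) y -> c y <> k - 1.
Proof.
  intros Hs Hadj. destruct (classic (spine y)) as [HD|HD].
  - rewrite (colour_spine _ _ _ _ _ _ colouring y HD). lia.
  - apply (colour_deviating _ _ _ _ _ _ colouring). split; eauto.
Qed.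

(** Tree-likeness gives a child [y] off the ray whose only lower neighbour is [R b n]. So [y] is off
    the spine and not deviating, and its class contains colour [k - 1]. With [selected_no_top],
    colours reveal the selected indices. *)
Lemma unselected_top b n :
  N0 + 4 <= n -> ~ selected b n -> exists y, adj (R b n) y /\ c y = k - 1.
Proof.
  intros Hn Hs. destruct n as [|n]; [lia|].
  destruct (R_tree b n ltac:(lia)) as [_ [y [Hy [Hy1 Hy2]]]].
  destruct (Rb_neighbour b n y ltac:(lia) Hy) as [E|[Hl Hlow]]; [easy|].
  assert (HD : ~ spine y).
  { intros HD. apply spine_cases in HD as [b' [E _]]. rewrite Hl in E.
    destruct (Rb_index b' b (S n) (S n)) as [Hb _]; [lia| |subst b'; easy].
    apply Hlow.
    - rewrite E. apply adj_Rb.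
    - rewrite level_Rb. lia. }
  destruct (colour_top _ _ _ _ _ _ colouring y HD) as [y' [Ht Hc]].
  - intros [_ [b' [n' [Hs' Hadj']]]].
    destruct (deviating_unique_lower y b' n' HD Hs' Hadj') as [_ Hlow'].
    destruct (Rb_index b b' (S n) n') as [<- <-]; [lia| |easy].
    apply Hlow'; [exact Hy|]. rewrite level_Rb. lia.
  - exists y'. split; [|exact Hc].
    apply (twins_lower_neighbour adj level spine y); auto. rewrite level_Rb. lia.
Qed.

Section Automorphism.
Context (g : V -> V) (g_aut : automorphism adj g) (g_colour : forall v, c (g v) = c v).

Lemma image_adj x y : adj x y -> adj (g x) (g y).
Proof. apply g_aut. Qed.

Lemma image_selected_no_top b n y : selected b n -> adj (g (R b n)) y -> c y <> k - 1.
Proof.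
  intros Hs Hadj. destruct (automorphism_inverse adj g g_aut) as [h [_ [_ Hgh]]].
  rewrite <- (Hgh y) in Hadj |- *. rewrite g_colour. apply (selected_no_top b n); auto.
  now apply (proj2 g_aut).
Qed.

Lemma c_Rb b n : b = true \/ N0 + 2 <= n -> c (R b n) = 0.
Proof.
  intros H. apply (colour_spine _ _ _ _ _ _ colouring).
  destruct b; [left; eauto|]. apply spine_Rb. destruct H; [discriminate|assumption].
Qed.

(** The image is eventually an upward walk through colour 0. Off the spine each of its vertices
    would see colour [k - 1], which images of selected vertices do not; on the spine, unique lower
    neighbours prevent it from changing rays. *)
Lemma image_eventually_on_ray b :
  exists N M b', forall j, g (R b (N + j)) = R b' (M + j).
Proof.
  destruct (automorphism_ray_level adj level r levels g (R b) g_aut (R_ray b)) as [N HN].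
  set (N' := N + N0 + 2).
  assert (HL : forall j, level (g (R b (N' + j))) = level (g (R b N')) + j).
  { apply (slope_one_run (fun n => level (g (R b n)))). intros n Hn. apply HN. lia. }
  set (M := level (g (R b N'))) in *.
  assert (Hrun : forall j, level (g (R b (N' + j))) = M + j /\
    adj (g (R b (N' + j))) (g (R b (N' + S j)))).
  { intros j. split; [apply HL|]. rewrite Nat.add_succ_r. apply image_adj, adj_Rb. }
  destruct (zero_run_dichotomy adj level r k adj_sym levels deg spine deviating c colouring
    deviating_lower (fun j => g (R b (N' + j))) M (N0 + 2) k_ge2)
    as [[J HJ]|(J & T & NT & _ & _ & HJ)].
  (* Return from off the spine is impossible: this high up, the only lower neighbour of a spine
     vertex is on the spine. *)
  - intros x d Hx HDx _ HDd Hxd Hl. apply HDx. apply spine_cases in HDd as [b' [E _]].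
    rewrite Hl in E. destruct (level x) as [|n] eqn:En; [lia|].
    rewrite (Rb_unique_lower b' n x); [apply spine_Rb; lia|lia|now rewrite <- E|lia].
  - exact Hrun.
  - intros j. rewrite g_colour. apply c_Rb. right. lia.
  - set (J' := J + N0 + 1).
    destruct (spine_cases _ (HJ J' ltac:(lia))) as [b' [E _]]. rewrite HL in E.
    exists (N' + J'), (M + J'), b'. intros j. rewrite <- !Nat.add_assoc.
    induction j as [|j IH]; [now rewrite !Nat.add_0_r|].
    destruct (spine_cases _ (HJ (J' + S j) ltac:(lia))) as [b'' [E' _]]. rewrite HL in E'.
    destruct (Rb_index b' b'' (M + (J' + j)) (M + (J' + j))) as [-> _]; [lia| |exact E'].
    rewrite <- IH.
    replace (M + (J' + j)) with (S (M + J' + j - 1)) at 1 by lia.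
    apply Rb_unique_lower; [lia| |].
    + replace (S (S (M + J' + j - 1))) with (M + (J' + S j)) by lia. rewrite <- E'.
      replace (J' + S j) with (S (J' + j)) by lia. apply Hrun.
    + rewrite HL. lia.
  - exfalso.
    (* A term selected for ray [b], late enough for its image to be off the spine. *)
    set (p := 2 * (N' + J) + if b then 0 else 1). pose proof (a_ge p) as Hp.
    set (j := a p - N').
    assert (HjJ : J <= j) by (unfold j, p in *; lia).
    destruct (off_spine_top_neighbour adj level k spine deviating c colouring deviating_lower
      (g (R b (N' + j))) (g (R b (N' + S j)))) as [y [Hy Hc]].
    + apply HJ. exact HjJ.
    + apply HJ. lia.
    + apply Hrun.
    + rewrite !HL. lia.
    + apply (image_selected_no_top b (N' + j) y); auto.
      exists (N' + J). unfold j, p in *. lia.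
Qed.

(** A late selected index goes to an index without neighbours of colour [k - 1], so again to a
    selected one. *)
Lemma image_eventually_fixed b : exists n, fixes_from g (R b) n.
Proof.
  destruct (image_eventually_on_ray b) as (N & M & b' & H).
  set (p := 2 * (N + M + N0 + 4) + if b then 0 else 1). pose proof (a_ge p) as Hp.
  set (j := a p - N).
  assert (Hj : N + j = a p) by (unfold j, p in *; lia).
  assert (Hsel : selected b' (M + j)).
  { apply NNPP. intros Hn.
    destruct (unselected_top b' (M + j)) as [y [Hy Hc]]; [unfold j, p in *; lia|exact Hn|].
    rewrite <- H in Hy. apply (image_selected_no_top b (N + j) y) in Hc; auto.
    exists (N + M + N0 + 4). exact Hj. }
  destruct Hsel as [i Hi].
  set (q := 2 * i + if b' then 0 else 1) in *.
  (* The terms [a p] and [a q] differ by [N - M], while distinct terms differ by more than a factor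
     of two. Once [p = q], parity identifies the ray and the shift is zero. *)
  assert (Hpq : p = q).
  { assert (2 * (N + M) <= a p) by (unfold p in *; lia).
    destruct (lt_eq_lt_dec p q) as [[Hlt|E]|Hgt]; [|exact E|]; exfalso.
    - apply a_increasing in Hlt. lia.
    - apply a_increasing in Hgt. lia. }
  assert (Hb : b = b') by (unfold p, q in Hpq; destruct b, b'; auto; lia).
  subst b'. rewrite <- Hpq in Hi. exists N. intros n Hn.
  replace n with (N + (n - N)) at 1 by lia. rewrite H. f_equal. lia.
Qed.

(** The image [x] is a neighbour of [R b (S n)] of colour 0. Off the spine it would have to be
    deviating, with [R b (S n)] as its selected lower neighbour; on the same ray, level and
    injectivity leave only [R b n]. *)
Lemma descend b n :
  (b = true \/ N0 + 2 <= n) -> fixes_from g (R b) (S n) -> ~ selected b (S n) ->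
  g (R b n) = R b n.
Proof.
  intros Hb Hfix Hsel.
  assert (Hadj : adj (R b (S n)) (g (R b n))).
  { rewrite <- (Hfix (S n)) by lia. apply image_adj, adj_sym, adj_Rb. }
  assert (H0 : c (g (R b n)) = 0) by (rewrite g_colour; now apply c_Rb).
  assert (Hinj : forall m, n < m -> g (R b n) <> R b m).
  { intros m Hm E. rewrite <- (Hfix m) in E by lia.
    apply (automorphism_injective adj) in E; [|exact g_aut].
    apply (f_equal level) in E. rewrite !level_Rb in E. lia. }
  set (x := g (R b n)) in *.
  assert (Hlx : level x = n \/ level x = S n \/ level x = S (S n)).
  { pose proof (level_step adj level r levels _ _ Hadj) as H1.
    pose proof (level_step adj level r levels _ _ (adj_sym _ _ Hadj)) as H2.
    rewrite level_Rb in *. lia. }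
  destruct (classic (spine x)) as [HD|HD].
  - destruct (spine_cases x HD) as [b' [E Hb']].
    destruct (Bool.bool_dec b' b) as [->|Hne].
    { destruct Hlx as [Hl|[Hl|Hl]]; rewrite Hl in E; [exact E| |];
      exfalso; apply (Hinj _) in E; auto; lia. }
    exfalso.
    assert (Hm : N0 + 2 <= level x) by (destruct b, b', Hb, Hb'; easy || lia).
    destruct (level x) as [|m]; [lia|].
    (* An edge between the rays would make [R b (S n)] equal to [R b' m], or [R b n] equal to
       [R b' (S m)], against disjointness. *)
    destruct (Rb_neighbour b' m (R b (S n))) as [E'|[Hl Hlow]]; [lia| | |].
    + rewrite <- E. now apply adj_sym.
    + destruct (Rb_index b' b m (S n)); [lia|now symmetry|easy].
    + destruct (Rb_index b' b (S m) n); [lia| |easy]. symmetry. apply Hlow.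
      * apply adj_Rb.
      * rewrite !level_Rb. lia.
  - exfalso.
    destruct (classic (deviating x)) as [[_ [b' [n' [Hs Hadj']]]]|HU].
    + destruct (deviating_unique_lower x b' n' HD Hs Hadj') as [Hl Hlow].
      pose proof (selected_ge b' n' Hs).
      destruct (Rb_neighbour b n x) as [E|[Hl' _]]; [lia|exact Hadj| |].
      * apply HD. rewrite E. apply spine_Rb. lia.
      * destruct (Rb_index b b' (S n) n') as [<- <-]; [lia| |easy].
        apply Hlow; [exact Hadj|]. rewrite level_Rb. lia.
    + apply (inner_neighbour_colour adj level k deg spine deviating c x); auto.
      now apply (Rb_inner b n).
Qed.

End Automorphism.

Context (blocking : forall n m,
  (n <= N0 + 2 /\ a 0 <= S m) \/ (exists i, n <= a i /\ a (S i) <= S m) ->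
  forall b g, automorphism adj g -> fixes_from g (R b) n -> fixes_from g (R (negb b)) (S m) ->
    g (R (negb b) m) = R (negb b) m).

(** For the least index from which the ray is fixed, [descend] would give a smaller one unless it is
    [low] or selected. *)
Lemma first_fixed g b low :
  automorphism adj g -> (forall v, c (g v) = c v) -> (b = true \/ N0 + 2 <= low) ->
  exists n, low <= n /\ fixes_from g (R b) n /\
    (n = low \/ (selected b n /\ forall m, n = S m -> g (R b m) <> R b m)).
Proof.
  intros Hg Hc Hlow.
  destruct (least_nat (fun n => low <= n /\ fixes_from g (R b) n)) as [n [[Hn Hfix] Hmin]].
  { destruct (image_eventually_fixed g Hg Hc b) as [n Hn]. exists (low + n).
    split; [lia|]. intros i Hi. apply Hn. lia. }
  exists n. split; [exact Hn|split; [exact Hfix|]].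
  destruct (Nat.eq_dec n low) as [E|Hne]; [now left|right].
  assert (Hmoved : forall m, n = S m -> g (R b m) <> R b m).
  { intros m -> E. enough (S m <= m) by lia. apply Hmin. split; [lia|].
    intros i Hi. destruct (Nat.eq_dec i m) as [->|]; [exact E|apply Hfix; lia]. }
  split; [|exact Hmoved]. apply NNPP. intros Hs. destruct n as [|n]; [lia|].
  apply (Hmoved n eq_refl). apply (descend g Hg Hc); auto. destruct Hlow; [now left|right; lia].
Qed.

(** If the spine is not fixed, some ray has a selected least fixed index. The larger such index is
    blocked by the smaller one or, if the other ray is fixed entirely, already by the bound on
    [a 0]. *)
Lemma two_rays_distinguishing : distinguishing_colouring adj k c.
Proof.
  split; [apply (colour_bound _ _ _ _ _ _ colouring)|].
  intros g Hg Hc.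
  destruct (first_fixed g true 0 Hg Hc) as (n & _ & Hn & Hn'); [now left|].
  destruct (first_fixed g false (N0 + 2) Hg Hc) as (m & Hm1 & Hm & Hm'); [now right|].
  assert (Hblock : forall b x y, fixes_from g (R b) x -> fixes_from g (R (negb b)) y ->
    (forall z, y = S z -> g (R (negb b) z) <> R (negb b) z) -> N0 + 4 <= y ->
    ~ ((x <= N0 + 2 /\ a 0 <= y) \/ (exists i, x <= a i /\ a (S i) <= y))).
  { intros b x y Hx Hy Hmoved Hge H. destruct y as [|y]; [lia|].
    apply (Hmoved y eq_refl). now apply (blocking x y H b g). }
  assert (Hstep : forall i j, i < j -> exists l, a i <= a l /\ a (S l) <= a j).
  { intros i j Hij. exists (j - 1). replace (S (j - 1)) with j by lia. split; [|lia].
    destruct (Nat.eq_dec i (j - 1)) as [->|]; [lia|].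
    pose proof (a_increasing i (j - 1) ltac:(lia)). lia. }
  destruct Hn' as [->|[Hsn Hmn]], Hm' as [->|[Hsm Hmm]].
  - apply (spine_rigid adj level r k levels spine deviating) with (c := c); auto.
    + left. exists 0. symmetry. apply (ray_root adj level r levels), R_ray.
    + intros v [[i ->]|[i [Hi ->]]]; [apply Hn|apply Hm]; lia.
  - exfalso. apply (Hblock true 0 m); auto; [now apply (selected_ge false)|].
    left. split; [lia|]. destruct Hsm as [i ->].
    pose proof (a_ge (2 * i + 1)). lia.
  - exfalso. apply (Hblock false (N0 + 2) n); auto; [now apply (selected_ge true)|].
    left. split; [lia|]. destruct Hsn as [i ->].
    pose proof (a_ge (2 * i + 0)). lia.
  - exfalso. pose proof (selected_ge _ _ Hsn). pose proof (selected_ge _ _ Hsm).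
    destruct Hsn as [i Hi], Hsm as [j Hj].
    (* The two rays use terms of opposite parity, so one index is strictly larger. *)
    destruct (lt_eq_lt_dec (2 * i + 0) (2 * j + 1)) as [[Hlt|E]|Hgt]; [|lia|].
    + apply (Hblock true n m); auto. right. rewrite Hi, Hj. now apply Hstep.
    + apply (Hblock false m n); auto. right. rewrite Hi, Hj. now apply Hstep.
Qed.
End TwoRays.

(** * Combining the two cases *)

(** Unique lower neighbours propagate a meeting point downwards, so rays that meet at arbitrarily
    high levels agree from [S N] on. *)
Lemma tree_like_rays_part {V : Type} (adj : V -> V -> Prop) (level : V -> nat)
    (R T : nat -> V) (N : nat) :
  ray adj level R -> ray adj level T ->
  tree_like_from adj level R N -> tree_like_from adj level T N ->
  ~ eventually_equal R T -> exists M, forall n, M <= n -> R n <> T n.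
Proof.
  intros HR HT HRt HTt Hne. apply NNPP. intros Hno. apply Hne. exists (S N).
  intros n Hn.
  assert (Hmeet : exists m, R (n + m) = T (n + m)).
  { apply NNPP. intros H. apply Hno. exists n. intros i Hi E. apply H. exists (i - n).
    now replace (n + (i - n)) with i by lia. }
  destruct Hmeet as [m Hm]. induction m as [|m IH]; [now rewrite Nat.add_0_r in Hm|].
  apply IH. replace (n + m) with (S (n + m - 1)) by lia.
  apply (tree_like_unique_lower adj level T N); auto; [lia| |].
  - replace (S (S (n + m - 1))) with (n + S m) by lia. rewrite <- Hm.
    replace (n + S m) with (S (S (n + m - 1))) by lia. apply HR.
  - rewrite (ray_level adj level R _ HR). lia.
Qed.

Theorem theorem1p3 (V : Type) (adj : V -> V -> Prop) (Delta : nat) :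
  simple_graph adj ->
  infinite_type V ->
  connected adj ->
  max_degree adj Delta ->
  3 <= Delta ->
  distinguishing_number_le adj (Delta - 1).
Proof.
  intros [adj_sym adj_irrefl] Hinf Hconn [Hmax [r _]] HDelta.
  set (k := Delta - 1). assert (Hk : 2 <= k) by (unfold k; lia).
  assert (deg : forall v, degree_le adj (S k) v).
  { intros v. destruct (Hmax v) as [d [[l [H1 [H2 H3]]] Hd]].
    exists l. split; [exact H1|split; [exact H2|unfold k; lia]]. }
  destruct (exists_levels adj r Hconn) as [level levels].
  destruct (classic (exists R, ray adj level R /\ forall T N, ray adj level T ->
    tree_like_from adj level T N -> eventually_equal T R)) as [[R [HR Honly]]|Hmany].
  - destruct (exists_spine_colouring adj level r k adj_sym levels deg
      (fun x => exists n, x = R n) (fun _ => False)) as [c Hc]; try easy.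
    + exists 0. symmetry. now apply (ray_root adj level r levels).
    + exists (R 1). split; [eauto|]. rewrite <- (ray_root adj level r levels R HR). apply HR.
    + exists c. now apply (single_ray_distinguishing adj level r k) with (R := R).
  - assert (Hother : forall R, ray adj level R -> exists T N, ray adj level T /\
      tree_like_from adj level T N /\ ~ eventually_equal T R).
    { intros R HR. apply NNPP. intros Hno. apply Hmany. exists R. split; [exact HR|].
      intros T N HT Htl. apply NNPP. intros Hne. apply Hno. eauto. }
    (* [R0] only starts the argument: failure for [R0] yields a tree-like [R1], and failure for [R1]
       a second tree-like ray with another tail. *)
    destruct (exists_ray adj level r (S k) levels deg Hinf) as [R0 HR0].
    destruct (Hother R0 HR0) as (R1 & N1 & HR1 & Ht1 & _).
    destruct (Hother R1 HR1) as (R2 & N2 & HR2 & Ht2 & Hne).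
    destruct (tree_like_rays_part adj level R2 R1 (N1 + N2)) as [M HM]; auto.
    { intros n Hn. apply Ht2. lia. }
    { intros n Hn. apply Ht1. lia. }
    set (N0 := N1 + N2 + M).
    set (R := fun b : bool => if b then R2 else R1).
    assert (R_ray : forall b, ray adj level (R b)) by (intros []; assumption).
    assert (R_tree : forall b, tree_like_from adj level (R b) N0).
    { intros [] n Hn; [apply Ht2|apply Ht1]; unfold N0 in Hn; lia. }
    destruct (exists_sparse_sequence (fun n m => forall b g, automorphism adj g ->
      fixes_from g (R b) n -> fixes_from g (R (negb b)) (S m) ->
      g (R (negb b) m) = R (negb b) m) (N0 + 4)) as (a & Ha0 & Hstart & Hgap).
    { intros n.
      pose proof (fun b => fixing_both_ends_bound adj level r (S k) (R b) (R (negb b)) N0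
        levels deg adj_sym (R_ray b) (R_ray (negb b)) (R_tree (negb b)) n) as HB.
      destruct (HB true) as [B1 HB1], (HB false) as [B2 HB2]. exists (B1 + B2).
      intros m Hm [] g Hg HgR HgT; [apply (HB1 m)|apply (HB2 m)]; auto; lia. }
    destruct (exists_two_ray_colouring adj level r k) with (R := R) (N0 := N0) (a := a)
      as [c Hc]; auto.
    { intros i. apply Hgap. }
    exists c. apply (two_rays_distinguishing adj level r k) with (R := R) (N0 := N0) (a := a);
      auto.
    + intros n Hn. apply HM. unfold N0 in Hn. lia.
    + intros i. apply Hgap.
    + intros n m [[Hn Hm]|[i [Hn Hm]]].
      * apply Hstart; lia.
      * destruct (Hgap i) as [_ H]. now apply H.
Qed.
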